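(* Let $S$ be an $r\times r$ (Laurent) polynomial matrix function which is positive definite almost everywhere on $\mathbb{T}$, and let $$S(z)=M(z)M^*(z),\qquad z\in\mathbb{T},$$ be its lower-upper factorization, where $$M(z)=\begin{pmatrix}f^+_1(z)&0&\cdots&0&0\\ \xi_{21}(z)&f^+_2(z)&\cdots&0&0\\ \vdots&\vdots&\ddots&\vdots&\vdots\\ \xi_{r-1,1}(z)&\xi_{r-1,2}(z)&\cdots&f^+_{r-1}(z)&0\\ \xi_{r1}(z)&\xi_{r2}(z)&\cdots&\xi_{r,r-1}(z)&f^+_r(z)\end{pmatrix}$$ is the lower triangular matrix with rational entries whose diagonal entries $f_i^+$ are the corresponding scalar spectral factors. If the entries of $M$ and the poles of the functions $\xi_{ij}$ inside $\mathbb{T}$ (i.e. in $\mathbb{D}$) are known exactly, then the spectral factorization of $S$ can also be found exactly, that is, a spectral factor $S_+$ of $S$ can be constructed exactly.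
   Context: $\mathbb{T}=\{z\in\mathbb{C}:|z|=1\}$ and $\mathbb{D}=\{z\in\mathbb{C}:|z|<1\}$. For a rational function $f$, $\widetilde{f}(z)=\overline{f(1/\overline z)}$; for a matrix $G=[G_{ij}]$ of rational functions, $\widetilde{G}=[\widetilde{G_{ji}}]$, so $\widetilde G(z)=G^*(z)$ (Hermitian conjugate) on $\mathbb{T}$. A Laurent polynomial matrix function has entries of the form $\sum_{k=k_1}^{k_2}c_kz^k$, $c_k\in\mathbb{C}$, $k_1\le k_2$ integers. $S$ positive definite a.e. on $\mathbb{T}$ means that $S(z)$ is positive definite for each $z\in\mathbb{T}$ except at some isolated points. A spectral factorization of $S$ is a representation $S(z)=S_+(z)\widetilde{S_+}(z)$, $z\in\mathbb{C}\setminus\{0\}$, where $S_+$ is an $r\times r$ matrix with entries polynomials in $z$ and $\det S_+(z)\neq 0$ for every $z\in\mathbb{D}$; such $S_+$ (a spectral factor) is unique up to right multiplication by a constant unitary matrix. That the diagonal entries $f_i^+$ of $M$ are scalar spectral factors means that each $f_i^+$ is a rational function without poles and without zeros in $\mathbb{D}$, with $f_i^+\widetilde{f_i^+}=\det[S]_{i\times i}/\det[S]_{(i-1)\times(i-1)}$, where $[S]_{i\times i}$ is the upper-left $i\times i$ submatrix of $S$ and $\det[S]_{0\times 0}:=1$. The $f_i^+$ are allowed to have zeros on $\mathbb{T}$, and the locations of such zeros are not assumed known. ''Construct''/''find exactly'' means finding the object exactly: for a polynomial, finding its coefficients exactly; for a rational function $f$, determining coprime polynomials $p,q$ with $f=p/q$.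 Determining coefficients of Laurent expansions and solving systems of linear equations with known coefficients count as exact operations. *)

(* Defs.v *)
From HB Require Import structures.
From mathcomp Require Import all_boot all_order all_algebra generic_quotient.
From mathcomp Require Export complex.
From mathcomp Require Export reals.

Set Implicit Arguments.
Unset Strict Implicit.
Unset Printing Implicit Defensive.
Import Order.TTheory GRing.Theory Num.Theory.
Local Open Scope ring_scope.
Local Open Scope quotient_scope.

Notation "x %:F" := (FracField.tofrac x) : ring_scope.

Lemma frac_reprE (A : idomainType) (f : {fraction A}) :
  f = (\n_(repr f))%:F / (\d_(repr f))%:F.
Proof.
have dF0 : (\d_(repr f))%:F != 0 by rewrite tofrac_eq0 denom_ratioP.
apply: (mulIf dF0); rewrite divfK //; elim/quotW: f {dF0} => x.
set y := repr _.
change (FracField.mul (\pi_({fraction A}) x) (\d_y)%:F = (\n_y)%:F).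
rewrite !piE; apply/eqmodP; rewrite /= FracField.equivfE /=.
rewrite /FracField.mulf !numden_Ratio ?oner_neq0 ?mulr1 ?denom_ratioP //.
by rewrite FracField.equivf_r.
Qed.

Section RationalFunctions.
Variable C : numClosedFieldType.
Local Notation ratfun := {fraction {poly C}}.
Implicit Types (f : ratfun) (p q : {poly C}) (z : C).

Definition reduced_form f p q : Prop :=
  [/\ q != 0, coprimep p q & f = p%:F / q%:F].

(* [repr] picks a numerator and a denominator which need not be coprime. *)
Definition fnum f : {poly C} :=
  let x := repr f in (\n_x)%R %/ gcdp \n_x \d_x.
Definition fden f : {poly C} :=
  let x := repr f in (\d_x)%R %/ gcdp \n_x \d_x.

Lemma fnum_fdenP f : reduced_form f (fnum f) (fden f).
Proof.
rewrite /fnum /fden; set x := repr f.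
have dx0 : \d_x != 0 by exact: denom_ratioP.
have g0 : gcdp \n_x \d_x != 0 by rewrite gcdp_eq0 negb_and dx0 orbT.
have nE := divpK (dvdp_gcdl \n_x \d_x); have dE := divpK (dvdp_gcdr \n_x \d_x).
have d0 : \d_x %/ gcdp \n_x \d_x != 0.
  by apply: contra_neq dx0 => d0; rewrite -dE d0 mul0r.
split=> //; first by rewrite coprimep_div_gcd // dx0 orbT.
rewrite [LHS]frac_reprE -/x -[in LHS]nE -[Y in _ / (Y)%:F = _]dE.
rewrite !rmorphM /= -mulf_div divff ?mulr1 //.
by rewrite tofrac_eq0.
Qed.

Definition pole f z : bool := root (fden f) z.
Definition zero f z : bool := root (fnum f) z.

(* The value of [f] at [z], meaningful when [z] is not a pole of [f]. *)
Definition feval f z : C := (fnum f).[z] / (fden f).[z].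

Lemma fevalE f p q z :
  f = p%:F / q%:F -> q.[z] != 0 -> ~~ pole f z /\ feval f z = p.[z] / q.[z].
Proof.
move=> fE qz0; have [d0 cop fE'] := fnum_fdenP f.
have q0 : q != 0 by apply: contraNneq qz0 => ->; rewrite horner0.
have E : p * fden f = fnum f * q.
  apply/eqP; rewrite -tofrac_eq !rmorphM /= -eqr_div ?tofrac_eq0 //.
  by rewrite -fE -fE'.
have Ez : p.[z] * (fden f).[z] = (fnum f).[z] * q.[z] by rewrite -!hornerM E.
have dz0 : (fden f).[z] != 0.
  apply/negP => /eqP dz; move: Ez; rewrite dz mulr0 => /esym/eqP.
  rewrite mulf_eq0 (negPf qz0) orbF => nz.
  have := coprimep_root cop nz; rewrite dz eqxx; exact.
split; first by rewrite /pole rootE.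
by apply/eqP; rewrite /feval eqr_div // -Ez.
Qed.

Definition mxeval m n (G : 'M[ratfun]_(m, n)) z : 'M[C]_(m, n) :=
  \matrix_(i, j) feval (G i j) z.

Definition laurent_poly f : Prop :=
  exists (k1 : int) (p : {poly C}), f = 'X%:F ^ k1 * p%:F.

(* conj (p (1 / conj z)), as a rational function of z *)
Definition ptilde p : ratfun :=
  \sum_(k < size p) ((p`_k)^*)%:P%:F * 'X%:F ^- k.

Definition ftilde f : ratfun := ptilde (fnum f) / ptilde (fden f).

Lemma ftildeE f z : z != 0 -> ~~ pole f (z^*)^-1 ->
  ~~ pole (ftilde f) z /\ feval (ftilde f) z = (feval f (z^*)^-1)^*.
Proof.
move=> z0 npole.
pose rv N p : {poly C} := \sum_(k < size p) ((p`_k)^*)%:P * 'X^(N - k).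
have X0 : ('X : {poly C})%:F != 0 by rewrite tofrac_eq0 polyX_eq0.
have ptE N p : (size p <= N)%N -> ptilde p = (rv N p)%:F / 'X%:F ^+ N.
  move=> leN; rewrite /ptilde /rv rmorph_sum mulr_suml /=.
  apply: eq_bigr => k _; rewrite rmorphM rmorphXn /= -mulrA; congr (_ * _).
  have lekN : (k <= N)%N by rewrite ltnW // (leq_trans (ltn_ord k)).
  by rewrite -[in X in _ / X](subnK lekN) exprD invfM mulrA divff ?mul1r ?expf_neq0.
have rvz N p : (size p <= N)%N -> (rv N p).[z] = (p.[(z^*)^-1])^* * z ^+ N.
  move=> leN; rewrite /rv horner_sum horner_coef rmorph_sum mulr_suml /=.
  apply: eq_bigr => k _; rewrite hornerM hornerC hornerXn rmorphM /= -mulrA.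
  have lekN : (k <= N)%N by rewrite ltnW // (leq_trans (ltn_ord k)).
  rewrite rmorphXn fmorphV /= conjCK exprVn; congr (_ * _).
  by rewrite -[in RHS](subnK lekN) exprD mulrCA mulVf ?mulr1 ?expf_neq0.
pose N := maxn (size (fnum f)) (size (fden f)).
have [leN leD] := (leq_maxl _ _ : size (fnum f) <= N, leq_maxr _ _ : size (fden f) <= N)%N.
have zN0 : z ^+ N != 0 by rewrite expf_neq0.
have [||np ->] := @fevalE (ftilde f) (rv N (fnum f)) (rv N (fden f)) z.
- rewrite /ftilde (ptE N) // (ptE N) // invfM invrK mulrACA mulVf ?mulr1 //.
  by rewrite expf_neq0.
- by rewrite rvz // mulf_neq0 // fmorph_eq0.
split=> //; rewrite !rvz // -mulf_div divff // mulr1.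
by rewrite /feval rmorphM fmorphV.
Qed.

Definition mxtilde m n (G : 'M[ratfun]_(m, n)) : 'M[ratfun]_(n, m) :=
  \matrix_(i, j) ftilde (G j i).

Local Open Scope sesquilinear_scope.

Definition posdef n (A : 'M[C]_n) : Prop :=
  A \is hermsymmx /\
  forall v : 'cV[C]_n, v != 0 -> 0 < (v^t* *m A *m v) 0 0.

Definition posdef_ae n (S : 'M[ratfun]_n) : Prop :=
  forall z, `|z| = 1 -> ~ posdef (mxeval S z) ->
  exists2 e : C, 0 < e &
    forall w, `|w| = 1 -> 0 < `|w - z| < e -> posdef (mxeval S w).

Definition leading_minor n (S : 'M[ratfun]_n) k (le_kn : (k <= n)%N) : ratfun :=
  \det (mxsub (widen_ord le_kn) (widen_ord le_kn) S).

(* Row [i : 'I_n] counts from 0, so this is det [S]_(i+1) / det [S]_i. *)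
Definition minor_ratio n (S : 'M[ratfun]_n) (i : 'I_n) : ratfun :=
  leading_minor S (ltn_ord i) / leading_minor S (ltnW (ltn_ord i)).

Definition scalar_spectral_factor (s f : ratfun) : Prop :=
  (forall z, `|z| < 1 -> ~~ pole f z && ~~ zero f z) /\ f * ftilde f = s.

Definition lower_upper_factorization n (S M : 'M[ratfun]_n) : Prop :=
  [/\ is_trig_mx M,
      forall i, scalar_spectral_factor (minor_ratio S i) (M i i)
    & forall z, `|z| = 1 -> (forall i j, ~~ pole (M i j) z) ->
        mxeval S z = mxeval M z *m (mxeval M z)^t*].

Definition spectral_factor n (S : 'M[ratfun]_n) (Sp : 'M[{poly C}]_n) : Prop :=
  let G := map_mx (@FracField.tofrac _) Sp in
  (forall z, z != 0 -> mxeval S z = mxeval G z *m mxeval (mxtilde G) z) /\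
  (forall z, `|z| < 1 -> (\det Sp).[z] != 0).

End RationalFunctions.

(* "Exact construction" is modelled by algebraic computation trees: finitely
   many field operations, complex conjugations and zero tests applied to the
   known data.  No complex constant other than 0 and 1 is available, and there
   is no root extraction, limit or order comparison.  Solving linear systems,
   computing Laurent coefficients of rational functions and reducing fractions
   to lowest terms are all of this kind. *)
Section ExactConstructions.
Variable I : Type.

Inductive exact_expr : Type :=
  | EVar of I
  | EZero
  | EOne
  | EOpp of exact_expr
  | EAdd of exact_expr & exact_expr
  | EMul of exact_expr & exact_expr
  | EInv of exact_expr
  | EConj of exact_expr.

Variable n : nat.

(* A leaf lists, for each entry of the constructed polynomial matrix, its
   coefficients by increasing degree. *)
Inductive exact_tree : Type :=
  | Output of 'M[seq exact_expr]_n
  | IfZero of exact_expr & exact_tree & exact_tree.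

Variables (C : numClosedFieldType) (env : I -> C).

Fixpoint eval_expr (e : exact_expr) : C :=
  match e with
  | EVar i => env i
  | EZero => 0
  | EOne => 1
  | EOpp e1 => - eval_expr e1
  | EAdd e1 e2 => eval_expr e1 + eval_expr e2
  | EMul e1 e2 => eval_expr e1 * eval_expr e2
  | EInv e1 => (eval_expr e1)^-1
  | EConj e1 => (eval_expr e1)^*
  end.

Fixpoint run_tree (t : exact_tree) : 'M[{poly C}]_n :=
  match t with
  | Output A => \matrix_(i, j) Poly [seq eval_expr e | e <- A i j]
  | IfZero e t1 t2 => if eval_expr e == 0 then run_tree t1 else run_tree t2
  end.

End ExactConstructions.

(* The known data: the first [d] coefficients of the numerators and of the
   denominators of the entries of M, and [k] points. *)
Inductive datum (r d k : nat) : Type :=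
  | NumCoef of 'I_r & 'I_r & 'I_d
  | DenCoef of 'I_r & 'I_r & 'I_d
  | PolePoint of 'I_k.

Definition known_data (C : numClosedFieldType) r d k
    (P Q : 'M[{poly C}]_r) (a : k.-tuple C) (x : datum r d k) : C :=
  match x with
  | NumCoef i j l => (P i j)`_l
  | DenCoef i j l => (Q i j)`_l
  | PolePoint l => tnth a l
  end.

(* Main.v *)
(* Write [M = N / q] with [N] a polynomial matrix and [q] the product of the
   denominators. The zeros of [q] and of [det N] in the open disk are poles of
   the [xi_ij], hence known. If [det N(a) = 0] with [|a| < 1] and [N(a) v = 0],
   multiply [N] on the right by the Blaschke-Potapov factor
   [(1 - P) + (1 - a^* z) / (z - a) P], where [P = v v^* / (v^* v)]: it is unitary
   on the circle, keeps [N] polynomial and lowers the order of [a] as a root of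
   [det N]. Each step is rational in the data and their conjugates, a bounded
   number of steps suffices, and it turns [N] and [q] (as a 1x1 matrix) into [N+]
   and [q+] without zeros in the disk. Then [S = N+ N+^* / |q+|^2] on the circle,
   and as [S] is a Laurent polynomial [q+] divides [N+]; the spectral factor is
   [N+ / q+]. *)

Require Import Defs.
From mathcomp Require Import all_boot all_order all_algebra.
From mathcomp Require Import complex reals ring.

Set Implicit Arguments.
Unset Strict Implicit.
Unset Printing Implicit Defensive.
Import Order.TTheory GRing.Theory Num.Theory.
Local Open Scope ring_scope.
Local Open Scope sesquilinear_scope.

(** * Functions of the data that computation trees can compute *)

Section Computable.
Variables (C : numClosedFieldType) (I : Type) (m : nat).
Local Notation env := (I -> C).
Local Notation tree := (exact_tree I m).

(* [F] is a computation in continuation-passing style: it branches on zero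
   tests until it holds an expression whose value is [f e], then resumes [K]. *)
Definition comp (f : env -> C) : Prop :=
  exists F : (exact_expr I -> tree) -> tree, forall K e,
  exists2 x, eval_expr e x = f e & run_tree e (F K) = run_tree e (K x).

Lemma comp_ext f g : comp f -> f =1 g -> comp g.
Proof.
case=> F FP fg; exists F => K e; have [x xE FE] := FP K e.
by exists x; rewrite // -fg.
Qed.

Lemma comp_var i : comp (fun e => e i).
Proof. by exists (fun K => K (EVar i)) => K e; exists (EVar i). Qed.

Lemma comp0 : comp (fun=> 0).
Proof. by exists (fun K => K (EZero I)) => K e; exists (EZero I). Qed.

Lemma comp1 : comp (fun=> 1).
Proof. by exists (fun K => K (EOne I)) => K e; exists (EOne I). Qed.

Lemma comp_unary (op : exact_expr I -> exact_expr I) (h : C -> C) f :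
    (forall e x, eval_expr e (op x) = h (eval_expr e x)) ->
  comp f -> comp (fun e => h (f e)).
Proof.
move=> opE [F FP]; exists (fun K => F (K \o op)) => K e.
by have [x xE ->] := FP (K \o op) e; exists (op x); rewrite ?opE ?xE.
Qed.

Lemma comp_binary (op : exact_expr I -> exact_expr I -> exact_expr I)
    (h : C -> C -> C) f g :
    (forall e x y, eval_expr e (op x y) = h (eval_expr e x) (eval_expr e y)) ->
  comp f -> comp g -> comp (fun e => h (f e) (g e)).
Proof.
move=> opE [F FP] [G GP].
exists (fun K => F (fun x => G (fun y => K (op x y)))) => K e.
have [x xE ->] := FP (fun x => G (fun y => K (op x y))) e.
by have [y yE ->] := GP (fun y => K (op x y)) e; exists (op x y); rewrite ?opE ?xE ?yE.
Qed.

Lemma compN f : comp f -> comp (fun e => - f e).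
Proof. exact: (@comp_unary (@EOpp I)). Qed.

Lemma compV f : comp f -> comp (fun e => (f e)^-1).
Proof. exact: (@comp_unary (@EInv I)). Qed.

Lemma comp_conj f : comp f -> comp (fun e => (f e)^*).
Proof. exact: (@comp_unary (@EConj I)). Qed.

Lemma compD f g : comp f -> comp g -> comp (fun e => f e + g e).
Proof. exact: (@comp_binary (@EAdd I)). Qed.

Lemma compM f g : comp f -> comp g -> comp (fun e => f e * g e).
Proof. exact: (@comp_binary (@EMul I)). Qed.

Lemma comp_if f g h :
  comp f -> comp g -> comp h -> comp (fun e => if f e == 0 then g e else h e).
Proof.
move=> [F FP] [G GP] [H HP].
exists (fun K => F (fun x => IfZero x (G K) (H K))) => K e.
have [x xE ->] := FP (fun x => IfZero x (G K) (H K)) e.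
by rewrite /= xE; case: eqP => _; [apply: GP | apply: HP].
Qed.

Lemma comp_sum (J : Type) (s : seq J) (P : pred J) (f : J -> env -> C) :
  (forall j, comp (f j)) -> comp (fun e => \sum_(j <- s | P j) f j e).
Proof.
move=> fP; elim: s => [|j s IHs].
  by apply: comp_ext comp0 _ => e; rewrite big_nil.
case Pj: (P j); last by apply: comp_ext IHs _ => e; rewrite big_cons Pj.
by apply: comp_ext (compD (fP j) IHs) _ => e; rewrite big_cons Pj.
Qed.

Lemma comp_exp f n : comp f -> comp (fun e => f e ^+ n).
Proof.
move=> fP; elim: n => [|n IHn]; first exact: comp1.
by apply: comp_ext (compM fP IHn) _ => e; rewrite exprS.
Qed.

Lemma comp_natr n : comp (fun=> n%:R).
Proof.
by elim: n => [|n IHn]; [exact: comp0 |];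
  apply: comp_ext (compD comp1 IHn) _ => e; rewrite mulrS.
Qed.

(** The computations run one after another, each inside the continuation of the preceding ones, so
    the last continuation holds expressions for all the values at once. *)
Lemma comp_finite (J : finType) (f : J -> env -> C) : (forall j, comp (f j)) ->
  exists F : ((J -> exact_expr I) -> tree) -> tree, forall K e,
  exists2 x, (forall j, eval_expr e (x j) = f j e)
           & run_tree e (F K) = run_tree e (K x).
Proof.
move=> fP.
suff [F FP]: exists F : ((J -> exact_expr I) -> tree) -> tree, forall K e,
    exists2 x, {in enum J, forall j, eval_expr e (x j) = f j e}
             & run_tree e (F K) = run_tree e (K x).
  by exists F => K e; have [x xE FE] := FP K e; exists x => // j; rewrite xE ?mem_enum.
elim: (enum J) => [|j s [F FP]].
  by exists (fun K => K (fun=> EZero I)) => K e; exists (fun=> EZero I).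
have [G GP] := fP j.
pose upd (x : J -> exact_expr I) y := fun i => if i == j then y else x i.
exists (fun K => F (fun x => G (fun y => K (upd x y)))) => K e.
have [x xE ->] := FP (fun x => G (fun y => K (upd x y))) e.
have [y yE ->] := GP (fun y => K (upd x y)) e.
exists (upd x y) => // i; rewrite inE /upd.
by case: eqP => [-> | _] //=; apply: xE.
Qed.

(** The size bound is uniform in the environment: a polynomial then amounts to finitely many
    computable scalars, and no degree has to be determined by the tree. *)
Definition compP (p : env -> {poly C}) : Prop :=
  (exists L, forall e, size (p e) <= L)%N /\ forall i, comp (fun e => (p e)`_i).

Lemma compP_ext p q : compP p -> p =1 q -> compP q.
Proof.
move=> [[L pL] pP] pq; split; first by exists L => e; rewrite -pq.
by move=> i; apply: comp_ext (pP i) _ => e; rewrite pq.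
Qed.

Lemma compPC f : comp f -> compP (fun e => (f e)%:P).
Proof.
move=> fP; split; first by exists 1 => e; exact: size_polyC_leq1.
case=> [|i]; first by apply: comp_ext fP _ => e; rewrite coefC.
by apply: comp_ext comp0 _ => e; rewrite coefC.
Qed.

Lemma compPX : compP (fun=> 'X).
Proof.
split; first by exists 2 => e; rewrite size_polyX.
by move=> i; apply: comp_ext (comp_natr (i == 1)) _ => e; rewrite coefX.
Qed.

Lemma compPD p q : compP p -> compP q -> compP (fun e => p e + q e).
Proof.
move=> [[L pL] pP] [[L' qL] qP]; split; last first.
  by move=> i; apply: comp_ext (compD (pP i) (qP i)) _ => e; rewrite coefD.
exists (maxn L L') => e; apply: leq_trans (size_polyD _ _) _.
by rewrite geq_max !leq_max pL qL orbT.
Qed.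

Lemma compPM p q : compP p -> compP q -> compP (fun e => p e * q e).
Proof.
move=> [[L pL] pP] [[L' qL] qP]; split; last first.
  move=> i; apply: comp_ext (comp_sum _ _ (fun j : 'I_i.+1 =>
    compM (pP j) (qP (i - j)%N))) _.
  by move=> e; rewrite coefM.
exists (L + L')%N => e; apply: leq_trans (size_polyMleq _ _) _.
by apply: leq_trans (leq_pred _) _; rewrite leq_add.
Qed.

Lemma compPN p : compP p -> compP (fun e => - p e).
Proof.
move=> pP; apply: compP_ext (compPM (compPC (compN comp1)) pP) _ => e.
by rewrite polyCN mulN1r.
Qed.

Lemma compPB p q : compP p -> compP q -> compP (fun e => p e - q e).
Proof. by move=> pP qP; exact: compPD pP (compPN qP). Qed.

Lemma compPZ f p : comp f -> compP p -> compP (fun e => f e *: p e).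
Proof.
by move=> fP pP; apply: compP_ext (compPM (compPC fP) pP) _ => e; rewrite mul_polyC.
Qed.

Lemma compP_sum (J : Type) (s : seq J) (P : pred J) (p : J -> env -> {poly C}) :
  (forall j, compP (p j)) -> compP (fun e => \sum_(j <- s | P j) p j e).
Proof.
move=> pP; elim: s => [|j s IHs].
  by apply: compP_ext (compPC comp0) _ => e; rewrite big_nil.
case Pj: (P j); last by apply: compP_ext IHs _ => e; rewrite big_cons Pj.
by apply: compP_ext (compPD (pP j) IHs) _ => e; rewrite big_cons Pj.
Qed.

Lemma compP_prod (J : Type) (s : seq J) (P : pred J) (p : J -> env -> {poly C}) :
  (forall j, compP (p j)) -> compP (fun e => \prod_(j <- s | P j) p j e).
Proof.
move=> pP; elim: s => [|j s IHs].
  by apply: compP_ext (compPC comp1) _ => e; rewrite big_nil.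
case Pj: (P j); last by apply: compP_ext IHs _ => e; rewrite big_cons Pj.
by apply: compP_ext (compPM (pP j) IHs) _ => e; rewrite big_cons Pj.
Qed.

Lemma compP_exp p n : compP p -> compP (fun e => p e ^+ n).
Proof.
move=> pP; elim: n => [|n IHn]; first exact: compPC comp1.
by apply: compP_ext (compPM pP IHn) _ => e; rewrite exprS.
Qed.

Lemma compP_take n p : compP p -> compP (fun e => take_poly n (p e)).
Proof.
move=> [[L pL] pP]; split; first by exists n => e; exact: size_take_poly.
move=> i; case ltin: (i < n)%N.
  by apply: comp_ext (pP i) _ => e; rewrite coef_take_poly ltin.
by apply: comp_ext comp0 _ => e; rewrite coef_take_poly ltin.
Qed.

Lemma compP_drop n p : compP p -> compP (fun e => drop_poly n (p e)).
Proof.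
move=> [[L pL] pP]; split; last first.
  by move=> i; apply: comp_ext (pP (i + n)%N) _ => e; rewrite coef_drop_poly.
by exists L => e; rewrite size_drop_poly (leq_trans (leq_subr _ _)).
Qed.

Lemma comp_horner p a : compP p -> comp a -> comp (fun e => (p e).[a e]).
Proof.
move=> [[L pL] pP] aP.
apply: comp_ext (comp_sum (index_enum 'I_L) xpredT (fun i : 'I_L =>
  compM (pP i) (comp_exp i aP))) _.
by move=> e; rewrite (horner_coef_wide _ (pL e)).
Qed.

Lemma compP_if f p q :
  comp f -> compP p -> compP q -> compP (fun e => if f e == 0 then p e else q e).
Proof.
move=> fP [[L pL] pP] [[L' qL] qP]; split; last first.
  by move=> i; apply: comp_ext (comp_if fP (pP i) (qP i)) _ => e; case: eqP.
by exists (maxn L L') => e; rewrite leq_max; case: eqP; rewrite ?pL ?qL ?orbT.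
Qed.

Definition comp_mx p q (A : env -> 'M[C]_(p, q)) : Prop :=
  forall i j, comp (fun e => A e i j).

Definition compP_mx p q (A : env -> 'M[{poly C}]_(p, q)) : Prop :=
  forall i j, compP (fun e => A e i j).

Lemma comp_mulmx p q s (A : env -> 'M_(p, q)) (B : env -> 'M_(q, s)) :
  comp_mx A -> comp_mx B -> comp_mx (fun e => A e *m B e).
Proof.
move=> AP BP i j.
apply: comp_ext (comp_sum (index_enum 'I_q) xpredT (fun k =>
  compM (AP i k) (BP k j))) _.
by move=> e; rewrite mxE.
Qed.

Lemma compP_mulmx p q s (A : env -> 'M_(p, q)) (B : env -> 'M_(q, s)) :
  compP_mx A -> compP_mx B -> compP_mx (fun e => A e *m B e).
Proof.
move=> AP BP i j.
apply: compP_ext (compP_sum (index_enum 'I_q) xpredT (fun k =>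
  compPM (AP i k) (BP k j))) _.
by move=> e; rewrite mxE.
Qed.

Lemma comp_trmxC p q (A : env -> 'M_(p, q)) :
  comp_mx A -> comp_mx (fun e => (A e)^t*).
Proof. by move=> AP i j; apply: comp_ext (comp_conj (AP j i)) _ => e; rewrite !mxE. Qed.

Lemma compP_det n (A : env -> 'M_n) : compP_mx A -> compP (fun e => \det (A e)).
Proof.
move=> AP; rewrite /determinant; apply: compP_sum => s; apply: compPM.
  by apply: compP_exp; apply: compP_ext (compPC (compN comp1)) _ => e; rewrite polyCN.
by apply: compP_prod => i; apply: AP.
Qed.

Lemma comp_horner_mx n (A : env -> 'M_n.+1) p :
  comp_mx A -> compP p -> comp_mx (fun e => horner_mx (A e) (p e)).
Proof.
move=> AP [[L pL] pP] i j.
have AX k : comp_mx (fun e => A e ^+ k).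
  elim: k => [|k IHk].
    by move=> u v; apply: comp_ext (comp_natr (u == v)) _ => e; rewrite expr0 mxE.
  by move=> u v; apply: comp_ext (comp_mulmx AP IHk u v) _ => e; rewrite exprS.
apply: comp_ext (comp_sum (index_enum 'I_L) xpredT (fun k : 'I_L =>
  compM (pP k) (AX k i j))) _.
move=> e.
have {2}->: p e = \sum_(k < L) (p e)`_k *: 'X^k.
  rewrite -poly_def; apply/polyP => k; rewrite coef_poly.
  by case: ltnP => // leLk; rewrite nth_default ?(leq_trans (pL e)).
rewrite rmorph_sum summxE /=; apply: eq_bigr => k _.
by rewrite linearZ /= rmorphXn /= horner_mx_X mxE.
Qed.

(** Uniform size bounds leave a finite family of coefficients, which [comp_finite] computes before
    an [Output] leaf lists them. *)
Lemma compP_mx_run (N : env -> 'M_m) :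
  compP_mx N -> exists T : tree, forall e, run_tree e T = N e.
Proof.
move=> NP.
have [L NL]: exists L, forall e i j, (size (N e i j) <= L)%N.
  have /fin_all_exists[l lP] (x : 'I_m * 'I_m) :
      exists L, forall e, (size (N e x.1 x.2) <= L)%N by case: (NP x.1 x.2).
  exists (\max_x l x) => e i j.
  by apply: leq_trans (lP (i, j) e) (leq_bigmax (F := l) (i, j)).
have [F FP] := comp_finite (fun x : 'I_m * 'I_m * 'I_L => (NP x.1.1 x.1.2).2 x.2).
pose out x := @Output I m (\matrix_(i, j) [seq x (i, j, k) | k <- enum 'I_L]).
exists (F out) => e; have [x xE ->] := FP out e.
apply/matrixP => i j; rewrite /= !mxE -map_comp; apply/polyP => k.
rewrite coef_Poly; case: (ltnP k L) => [ltkL | leLk]; last first.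
  by rewrite !nth_default ?(leq_trans (NL _ _ _)) // size_map size_enum_ord.
rewrite (nth_map (Ordinal ltkL)) ?size_enum_ord //=.
by rewrite -[k]/(val (Ordinal ltkL)) nth_ord_enum xE.
Qed.

(** * Kernel vectors found by zero tests *)

Definition sqnorm p q (A : 'M[C]_(p, q)) : C :=
  \sum_i \sum_j A i j * (A i j)^*.

Lemma sqnorm_eq0 p q (A : 'M[C]_(p, q)) : (sqnorm A == 0) = (A == 0).
Proof.
apply/eqP/eqP => [|->]; last first.
  by apply: big1 => i _; apply: big1 => j _; rewrite mxE mul0r.
have rowge0 i : 0 <= \sum_j A i j * (A i j)^*.
  by apply: sumr_ge0 => j _; exact: mul_conjC_ge0.
move/eqP; rewrite psumr_eq0 // => /allP A0; apply/matrixP => i j.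
have := A0 i (mem_index_enum i); rewrite psumr_eq0 => [/allP Ai0|k _];
  last exact: mul_conjC_ge0.
by have := Ai0 j (mem_index_enum j); rewrite /= mul_conjC_eq0 mxE => /eqP.
Qed.

Lemma comp_sqnorm p q (A : env -> 'M_(p, q)) :
  comp_mx A -> comp (fun e => sqnorm (A e)).
Proof.
by move=> AP; apply: comp_sum => i; apply: comp_sum => j; apply/compM/comp_conj.
Qed.

(** A bounded search: [v] takes the candidate of largest index below [n] that passes its test, with
    [c 0] as the default. *)
Lemma comp_select p q (c : nat -> env -> 'M_(p, q)) (t : nat -> env -> C) n :
    (forall k, comp_mx (c k)) -> (forall k, comp (t k)) ->
  exists2 v, comp_mx v & forall e, (exists2 k, (k < n)%N & t k e = 0) ->
    exists2 k, t k e = 0 & v e = c k e.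
Proof.
move=> cP tP; elim: n => [|n [v vP IHn]]; first by exists (c 0%N) => // e [].
exists (fun e => if t n e == 0 then c n e else v e) => [i j|e [k]].
  by apply: comp_ext (comp_if (tP n) (cP n i j) (vP i j)) _ => e; case: eqP.
rewrite ltnS leq_eqVlt => ltkn tk0; case: eqP => [tn0|tn0]; first by exists n.
by apply: IHn; exists k => //; case/predU1P: ltkn tk0 => // ->.
Qed.

(** One scalar whose vanishing encodes a conjunction of [B != 0] and [A *m B = 0]; the value 1
    rejects [B = 0]. *)
Definition kernel_test p q s (A : 'M[C]_(p, q)) (B : 'M[C]_(q, s)) : C :=
  if sqnorm B == 0 then 1 else sqnorm (A *m B).

Lemma kernel_testP p q s (A : 'M[C]_(p, q)) (B : 'M[C]_(q, s)) :
  kernel_test A B = 0 <-> B != 0 /\ A *m B = 0.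
Proof.
rewrite /kernel_test sqnorm_eq0; case: eqP => [_|_].
  by split=> [/eqP | []//]; rewrite oner_eq0.
by split=> [/eqP | [_ ->]]; [rewrite sqnorm_eq0 => /eqP | apply/eqP; rewrite sqnorm_eq0].
Qed.

Lemma comp_kernel_test p q s (A : env -> 'M_(p, q)) (B : env -> 'M_(q, s)) :
  comp_mx A -> comp_mx B -> comp (fun e => kernel_test (A e) (B e)).
Proof.
move=> AP BP; apply: comp_if; [exact: comp_sqnorm | exact: comp1 |].
exact/comp_sqnorm/comp_mulmx.
Qed.

(* The Horner partial sums [K] of the characteristic polynomial at [A] end with
   [0] by Cayley-Hamilton; the last nonzero one satisfies [A *m K = - c%:M] for
   some coefficient [c], which vanishes because [A] is singular. *)
Lemma singular_horner n (A : 'M[C]_n.+1) : \det A = 0 ->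
  exists2 k, (k < n.+1)%N &
    let K := horner_mx A (drop_poly k.+1 (char_poly A)) in K != 0 /\ A *m K = 0.
Proof.
move=> A0; pose K k := horner_mx A (drop_poly k (char_poly A)).
have Kn : K n.+1 != 0.
  rewrite /K (_ : drop_poly _ _ = 1%:P) ?rmorph1 ?oner_eq0 //.
  apply/polyP => -[|i]; rewrite coef_drop_poly coefC /=.
    have /monicP := char_poly_monic A.
    by rewrite /lead_coef size_char_poly.
  by rewrite nth_default // size_char_poly addSn ltnS addnS ltnS leq_addl.
have exK : exists k, K k != 0 by exists n.+1.
case: (ex_minnP exK) => -[|k] Kk minK.
  by move: Kk; rewrite /K drop_poly0l Cayley_Hamilton eqxx.
exists k; first by apply: minK.
split=> //; rewrite -/(K k.+1).
have dropE : drop_poly k (char_poly A) =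
    'X * drop_poly k.+1 (char_poly A) + ((char_poly A)`_k)%:P.
  apply/polyP => -[|i]; rewrite coefD coefXM coefC !coef_drop_poly /= ?add0r ?addr0 //.
  by rewrite addnS.
have AK : A *m K k.+1 = - ((char_poly A)`_k)%:M.
  apply/eqP; rewrite -addr_eq0; apply/eqP.
  have: K k = 0 by apply/eqP/negbNE/negP => /minK; rewrite ltnn.
  by rewrite /K dropE rmorphD rmorphM /= horner_mx_X horner_mx_C.
(* Taking determinants of [A *m K = - c%:M] turns the singularity of [A] into a vanishing power of
   [- c]. *)
have: \det (A *m K k.+1) = 0 by rewrite det_mulmx A0 mul0r.
rewrite AK -raddfN det_scalar => /eqP; rewrite expf_eq0 oppr_eq0 /= => /eqP->.
by rewrite oppr0 raddf0.
Qed.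

(** Two successive searches: first for a nonzero Horner sum killed by [A], then for a nonzero column
    of it. *)
Lemma comp_kernel n (A : env -> 'M_n.+1) : comp_mx A ->
  exists2 v : env -> 'cV_n.+1, comp_mx v &
    forall e, \det (A e) = 0 -> v e != 0 /\ A e *m v e = 0.
Proof.
move=> AP; pose c k e := horner_mx (A e) (drop_poly k.+1 (char_poly (A e))).
have cP k : comp_mx (c k).
  apply/comp_horner_mx/compP_drop/compP_det => // i j.
  have pP := compPB (compPM (compPC (comp_natr (i == j))) compPX) (compPC (AP i j)).
  apply: compP_ext pP _ => e; rewrite !mxE.
  by case: eqP; rewrite ?mul1r ?mul0r.
have [B BP BE] := comp_select n.+1 cP (fun k => comp_kernel_test AP (cP k)).
pose cl k e := col (inord k : 'I_n.+1) (B e).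
have clP k : comp_mx (cl k).
  by move=> i j; apply: comp_ext (BP i (inord k)) _ => e; rewrite mxE.
have [v vP vE] := comp_select n.+1 clP (fun k => comp_kernel_test AP (clP k)).
exists v => // e /singular_horner[k ltkn /kernel_testP tk].
have [j /kernel_testP cj BeE] : exists2 k, kernel_test (A e) (c k e) = 0 & B e = c k e.
  by apply: BE; exists k.
move: cj; rewrite -BeE => -[B0 AB].
have [i /kernel_testP wi veE] : exists2 k, kernel_test (A e) (cl k e) = 0 & v e = cl k e.
  apply: vE; have [i Bi] : exists i, col i (B e) != 0.
    apply/existsP; apply: contraNT B0 => /existsPn B0; apply/eqP/matrixP => x y.
    by have := B0 y => /negbNE/eqP/matrixP/(_ x 0); rewrite !mxE.
  exists i => //; apply/kernel_testP; rewrite /cl inord_val; split=> //.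
  by rewrite colE mulmxA AB mul0mx.
by rewrite veE.
Qed.

End Computable.

(** * Blaschke-Potapov factors and the lowering of the order of a root *)

Section Blaschke.
Variable C : numClosedFieldType.
Implicit Types (a z : C) (p q : {poly C}).

Definition evmx m n z (N : 'M[{poly C}]_(m, n)) : 'M[C]_(m, n) :=
  map_mx (horner_eval z) N.

Lemma det_evmx n z (N : 'M[{poly C}]_n) : \det (evmx z N) = (\det N).[z].
Proof. by rewrite /evmx det_map_mx. Qed.

Lemma evmxM m n s z (A : 'M[{poly C}]_(m, n)) (B : 'M[{poly C}]_(n, s)) :
  evmx z (A *m B) = evmx z A *m evmx z B.
Proof. exact: map_mxM. Qed.

Lemma evmxZ m n z p (A : 'M[{poly C}]_(m, n)) : evmx z (p *: A) = p.[z] *: evmx z A.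
Proof. exact: map_mxZ. Qed.

Lemma evmx_polyC m n z (A : 'M[C]_(m, n)) : evmx z (map_mx polyC A) = A.
Proof. by apply/matrixP => i j; rewrite !mxE; apply: hornerC. Qed.

Lemma trmxCZ m n (c : C) (A : 'M[C]_(m, n)) : (c *: A)^t* = c^* *: A^t*.
Proof. by apply/matrixP => i j; rewrite !mxE rmorphM. Qed.

(* The Blaschke-Potapov factor [(1 - P) + (1 - a^* X) / (X - a) P], cleared of
   its denominator [X - a]. *)
Definition blaschke_mx n a (P : 'M[C]_n) : 'M[{poly C}]_n :=
  ('X - a%:P) *: map_mx polyC (1%:M - P) + (1 - a^* *: 'X) *: map_mx polyC P.

(** The two scalars of [blaschke_mx] exchanged, which gives its inverse up to the scalar
    [(X - a) (1 - a^* X)]. *)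
Definition blaschke_adj n a (P : 'M[C]_n) : 'M[{poly C}]_n :=
  (1 - a^* *: 'X) *: map_mx polyC (1%:M - P) + ('X - a%:P) *: map_mx polyC P.

(** [P] and [1 - P] are idempotents with product zero, so the scalars multiply separately on the two
    ranges. *)
Lemma mul_proj_pencil (R : comNzRingType) n (P : 'M[R]_n) (x y x' y' : R) :
  P *m P = P ->
  (x *: (1%:M - P) + y *: P) *m (x' *: (1%:M - P) + y' *: P) =
  (x * x') *: (1%:M - P) + (y * y') *: P.
Proof.
move=> PP; rewrite mulmxDl !mulmxDr -!scalemxAl -!scalemxAr.
rewrite !mulmxBl !mulmxBr !mul1mx !mulmx1 PP subrr !subr0 !scaler0 addr0 add0r.
by rewrite !scalerA.
Qed.

Lemma blaschke_mxK n a (P : 'M[C]_n) : P *m P = P ->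
  blaschke_mx a P *m blaschke_adj a P = (('X - a%:P) * (1 - a^* *: 'X))%:M.
Proof.
move=> PP; rewrite /blaschke_mx /blaschke_adj !map_mxB !map_mx1.
rewrite mul_proj_pencil -?map_mxM ?PP // [X in _ + X *: _]mulrC.
by rewrite -scalerDr subrK scalemx1.
Qed.

(** On the circle [1 - a^* z = z (z - a)^*], so both scalars of the pencil have modulus
    [|z - a|]. *)
Lemma blaschke_unitary n a z (P : 'M[C]_n) :
    P *m P = P -> P^t* = P -> `|z| = 1 ->
  evmx z (blaschke_mx a P) *m (evmx z (blaschke_mx a P))^t* = (`|z - a| ^+ 2)%:M.
Proof.
move=> PP Ph z1.
have -> : evmx z (blaschke_mx a P) = (z - a) *: (1%:M - P) + (1 - a^* * z) *: P.
  by rewrite /blaschke_mx /evmx map_mxD -!/(evmx _ _) !evmxZ !evmx_polyC !hornerE.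
have -> : ((z - a) *: (1%:M - P) + (1 - a^* * z) *: P)^t* =
    (z - a)^* *: (1%:M - P) + (1 - a^* * z)^* *: P.
  rewrite linearD !linearZ linearB /= trmx1 map_mxD !map_mxZ map_mxB map_mx1.
  by rewrite Ph.
rewrite mul_proj_pencil // -!normCK.
have -> : 1 - a^* * z = z * (z - a)^*.
  by rewrite rmorphB mulrBr -normCK z1 expr1n [z * _]mulrC.
by rewrite normrM z1 mul1r norm_conjC -scalerDr subrK scalemx1.
Qed.

Lemma coprimep_blaschke a :
  `|a| < 1 -> coprimep ('X - a%:P) (1 - a^* *: 'X).
Proof.
move=> a1; rewrite coprimep_sym coprimep_XsubC rootE !hornerE mulrC -normCK.
by rewrite subr_eq0 eq_sym lt_eqF // expr_lt1.
Qed.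

(** The orthogonal projection onto the line of [v]; dividing by the squared norm avoids a square
    root. *)
Definition range_proj n (v : 'cV[C]_n) : 'M[C]_n := (sqnorm v)^-1 *: (v *m v^t*).

Lemma sqnormE n (v : 'cV[C]_n) : v^t* *m v = (sqnorm v)%:M.
Proof.
apply/matrixP => i j; rewrite !ord1 !mxE eqxx mulr1n; apply: eq_bigr => k _.
by rewrite big_ord1 !mxE mulrC.
Qed.

Lemma range_projP n (v : 'cV[C]_n) : v != 0 ->
  [/\ range_proj v *m range_proj v = range_proj v,
      (range_proj v)^t* = range_proj v & range_proj v *m v = v].
Proof.
move=> v0; have s0 : sqnorm v != 0 by rewrite sqnorm_eq0.
have Pv : range_proj v *m v = v.
  by rewrite /range_proj -scalemxAl -mulmxA sqnormE mul_mx_scalar scalerA mulVf ?scale1r.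
split=> //.
  by rewrite {2}/range_proj -scalemxAr mulmxA Pv.
have sr : (sqnorm v)^* = sqnorm v.
  rewrite rmorph_sum; apply: eq_bigr => i _.
  by rewrite rmorph_sum; apply: eq_bigr => j _; rewrite rmorphM /= conjCK mulrC.
apply/matrixP => i j; rewrite !mxE !big_ord1 !mxE !rmorphM /= conjCK fmorphV.
by congr (_^-1 * _); [exact: sr | exact: mulrC].
Qed.

(* Right multiplication by [blaschke_mx a P / (X - a)], exact when the columns
   of [P] are killed by the value of [N] at [a]. *)
Definition blaschke_step n a (P : 'M[C]_n) (N : 'M[{poly C}]_n) : 'M[{poly C}]_n :=
  let NP := N *m map_mx polyC P in
  N - NP + (1 - a^* *: 'X) *: map_mx (fun p => p %/ ('X - a%:P)) NP.

Section Step.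
Variables (n : nat) (a : C) (P : 'M[C]_n) (N : 'M[{poly C}]_n).
Hypotheses (PP : P *m P = P) (NaP : evmx a N *m P = 0).
Local Notation N' := (blaschke_step a P N).

Lemma blaschke_stepE : ('X - a%:P) *: N' = N *m blaschke_mx a P.
Proof.
rewrite /blaschke_step; set NP := N *m _.
have NPE : ('X - a%:P) *: map_mx (fun p => p %/ ('X - a%:P)) NP = NP.
  apply/matrixP => i j; rewrite mxE [X in _ * X]mxE mulrC divpK // dvdp_XsubCl.
  have : evmx a NP = 0 by rewrite evmxM evmx_polyC.
  by move/matrixP/(_ i j); rewrite [LHS]mxE [RHS]mxE rootE => /eqP.
rewrite scalerDr scalerA mulrC -scalerA NPE /blaschke_mx mulmxDr -!scalemxAr.
by rewrite map_mxB map_mx1 mulmxBr mulmx1.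
Qed.

(** Multiply [blaschke_stepE] on the right by [blaschke_adj] and cancel [X - a]. This form yields
    the determinant relation used to compare roots. *)
Lemma blaschke_stepK : (1 - a^* *: 'X) *: N = N' *m blaschke_adj a P.
Proof.
have X0 : 'X - a%:P != 0 by rewrite polyXsubC_eq0.
apply/matrixP => i j; apply: (mulfI X0).
transitivity ((('X - a%:P) *: N' *m blaschke_adj a P) i j); last first.
  by rewrite -scalemxAl [LHS]mxE.
by rewrite blaschke_stepE -mulmxA blaschke_mxK // mul_mx_scalar !mxE mulrA.
Qed.

Lemma det_blaschke_step :
  (1 - a^* *: 'X) ^+ n * \det N = \det N' * \det (blaschke_adj a P).
Proof. by rewrite -det_mulmx -blaschke_stepK detZ. Qed.

Lemma blaschke_step_circle z : `|a| < 1 -> P^t* = P -> `|z| = 1 ->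
  evmx z N' *m (evmx z N')^t* = evmx z N *m (evmx z N)^t*.
Proof.
move=> a1 Ph z1; have /= := congr1 (evmx z) blaschke_stepE.
rewrite evmxZ evmxM !hornerE => E.
have za : `|z - a| ^+ 2 != 0.
  rewrite expf_eq0 /= normr_eq0 subr_eq0; apply: contraTneq a1 => <-.
  by rewrite z1 ltxx.
apply: (scalerI za).
transitivity (((z - a) *: evmx z N') *m ((z - a) *: evmx z N')^t*).
  by rewrite trmxCZ -scalemxAl -scalemxAr scalerA -normCK.
rewrite E trmx_mul map_mxM mulmxA -[evmx z N *m _ *m _]mulmxA blaschke_unitary //.
by rewrite mul_mx_scalar -scalemxAl.
Qed.

(** By the determinant relation a new root could only be a zero of [1 - a^* X], and this has none in
    the disk. *)
Lemma blaschke_step_root z :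
  `|a| < 1 -> `|z| < 1 -> root (\det N') z -> root (\det N) z.
Proof.
move=> a1 z1 /rootP r; have := congr1 (horner^~ z) det_blaschke_step.
rewrite !hornerM r mul0r => /eqP; rewrite mulf_eq0 => /orP[|//].
rewrite horner_exp expf_eq0 !hornerE => /andP[_]; rewrite subr_eq0 => /eqP E.
have : `|a^* * z| < 1 by rewrite normrM norm_conjC mulr_ilt1.
by rewrite -E normr1 ltxx.
Qed.

(** The value of [blaschke_adj] at [a] kills [v], so its determinant supplies the extra factor
    [X - a]; the power of [1 - a^* X] is coprime to [X - a] and drops out. *)
Lemma blaschke_step_mult (v : 'cV_n) k : `|a| < 1 -> v != 0 -> P *m v = v ->
  ('X - a%:P) ^+ k %| \det N' -> ('X - a%:P) ^+ k.+1 %| \det N.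
Proof.
move=> a1 v0 Pv dvk; have cop := coprimep_blaschke a1.
have : ('X - a%:P) ^+ k.+1 %| (1 - a^* *: 'X) ^+ n * \det N.
  rewrite det_blaschke_step exprS mulrC dvdp_mul // dvdp_XsubCl rootE -det_evmx -det_tr.
  apply/det0P; exists v^T; first by rewrite -trmx0 (inj_eq trmx_inj).
  rewrite -trmx_mul /blaschke_adj /evmx map_mxD -!/(evmx _ _) !evmxZ !evmx_polyC.
  rewrite !hornerE subrr scale0r addr0 -scalemxAl mulmxBl mul1mx Pv subrr.
  by rewrite scaler0 trmx0.
by rewrite Gauss_dvdpr // coprimep_expl // coprimep_expr.
Qed.

End Step.
End Blaschke.

(** Synthetic division: each coefficient of the quotient is a Horner value, hence computable without
    a division algorithm on polynomials. *)
Lemma coef_divXsubC (F : fieldType) (p : {poly F}) a i :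
  (p %/ ('X - a%:P))`_i = (drop_poly i.+1 p).[a].
Proof.
set q := p %/ _.
have dropE : drop_poly i q = drop_poly i.+1 q * 'X + (q`_i)%:P.
  apply/polyP => -[|j]; rewrite coefD coefMX coefC !coef_drop_poly /= ?add0r ?addr0 //.
  by rewrite addnS.
have -> : drop_poly i.+1 p = drop_poly i q - drop_poly i.+1 q * a%:P.
  apply/polyP => j; rewrite coefB coefMC !coef_drop_poly.
  rewrite [in LHS](divp_eq p ('X - a%:P)) modp_XsubC -/q coefD coefC addnS /= addr0.
  by rewrite mulrBr coefB coefMC coefMX.
by rewrite dropE !hornerE addrAC subrr add0r.
Qed.

(** * Computable removal of the known roots in the disk *)

Section ClearRoots.
Variables (C : numClosedFieldType) (I : Type) (m : nat).
Local Notation env := (I -> C).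
Local Notation comp := (@comp C I m).
Local Notation compP := (@compP C I m).
Local Notation comp_mx := (@comp_mx C I m).
Local Notation compP_mx := (@compP_mx C I m).
Implicit Types (a : env -> C).

Lemma compP_divXsubC p a :
  compP p -> comp a -> compP (fun e => p e %/ ('X - (a e)%:P)).
Proof.
move=> pP aP; split; last first.
  move=> i; apply: comp_ext (comp_horner (compP_drop i.+1 pP) aP) _ => e.
  by rewrite coef_divXsubC.
case: pP => -[L pL] _; exists L => e.
by rewrite size_divp ?polyXsubC_eq0 // (leq_trans (leq_subr _ _)).
Qed.

Lemma comp_evmx p q (N : env -> 'M_(p, q)) a :
  compP_mx N -> comp a -> comp_mx (fun e => evmx (a e) (N e)).
Proof.
move=> NP aP i j; apply: comp_ext (comp_horner (NP i j) aP) _ => e.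
by rewrite mxE.
Qed.

Lemma comp_range_proj n (v : env -> 'cV_n) :
  comp_mx v -> comp_mx (fun e => range_proj (v e)).
Proof.
move=> vP i j; apply: comp_ext (compM (compV (comp_sqnorm vP)) _) _ => [|e];
  last by rewrite mxE.
exact: comp_mulmx vP (comp_trmxC vP) i j.
Qed.

Lemma compP_blaschke_step n a (P : env -> 'M_n) (N : env -> 'M_n) :
    comp a -> comp_mx P -> compP_mx N ->
  compP_mx (fun e => blaschke_step (a e) (P e) (N e)).
Proof.
move=> aP PP NP i j.
have NPP : compP_mx (fun e => N e *m map_mx polyC (P e)).
  apply: compP_mulmx NP _ => u v; apply: compP_ext (compPC (PP u v)) _ => e.
  by rewrite mxE.
have cP : compP (fun e => 1 - (a e)^* *: 'X).
  by apply: compPB (compPC (comp1 _ _ _)) (compPZ (comp_conj aP) (compPX _ _ _)).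
apply: compP_ext (compPD (compPB (NP i j) (NPP i j))
   (compPM cP (compP_divXsubC (NPP i j) aP))) _ => e.
by rewrite /blaschke_step !mxE.
Qed.

(** A zero test at [a] decides whether a Blaschke step is made. The last clause says that the order
    drops, in a form that can be iterated: if [a] is still a root afterwards, the order before was
    larger. *)
Lemma lower_root_order n (N : env -> 'M_n.+1) a : compP_mx N -> comp a ->
  exists2 N', compP_mx N' & forall e, `|a e| < 1 ->
  [/\ forall z, `|z| = 1 ->
        evmx z (N' e) *m (evmx z (N' e))^t* = evmx z (N e) *m (evmx z (N e))^t*,
      forall z, `|z| < 1 -> root (\det (N' e)) z -> root (\det (N e)) z
    & forall k, root (\det (N' e)) (a e) ->
        ('X - (a e)%:P) ^+ k %| \det (N' e) -> ('X - (a e)%:P) ^+ k.+1 %| \det (N e)].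
Proof.
move=> NP aP; have [v vP vK] := comp_kernel (comp_evmx NP aP).
have sP := compP_blaschke_step aP (comp_range_proj vP) NP.
have dP := comp_horner (compP_det NP) aP.
exists (fun e => if (\det (N e)).[a e] == 0 then
    blaschke_step (a e) (range_proj (v e)) (N e) else N e) => [i j|e a1].
  by apply: compP_ext (compP_if dP (sP i j) (NP i j)) _ => e; case: eqP.
case: ifPn => [/eqP d0|nr]; last by split=> // k; rewrite rootE (negPf nr).
have [v0 Av] : v e != 0 /\ evmx (a e) (N e) *m v e = 0.
  by apply: vK; rewrite det_evmx.
have [PP Ph Pv] := range_projP v0.
have NaP : evmx (a e) (N e) *m range_proj (v e) = 0.
  by rewrite /range_proj -scalemxAr mulmxA Av mul0mx scaler0.
split=> [z z1|z z1|k _]; first exact: blaschke_step_circle.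
  exact: blaschke_step_root.
exact: blaschke_step_mult v0 Pv.
Qed.

(** With [L] a uniform bound on the size of [\det N], [L] conditional steps suffice: a root
    surviving them would make [(X - a) ^ L], of size [L + 1], divide a nonzero polynomial of size at
    most [L]. *)
Lemma clear_root n (N : env -> 'M_n.+1) a : compP_mx N -> comp a ->
  exists2 N', compP_mx N' & forall e, `|a e| < 1 -> \det (N e) != 0 ->
  [/\ forall z, `|z| = 1 ->
        evmx z (N' e) *m (evmx z (N' e))^t* = evmx z (N e) *m (evmx z (N e))^t*,
      forall z, `|z| < 1 -> root (\det (N' e)) z -> root (\det (N e)) z
    & ~~ root (\det (N' e)) (a e)].
Proof.
move=> NP aP; have [[L NL] _] := compP_det NP.
have [N' N'P N'E] : exists2 N', compP_mx N' & forall e, `|a e| < 1 ->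
  [/\ forall z, `|z| = 1 ->
        evmx z (N' e) *m (evmx z (N' e))^t* = evmx z (N e) *m (evmx z (N e))^t*,
      forall z, `|z| < 1 -> root (\det (N' e)) z -> root (\det (N e)) z
    & forall k, root (\det (N' e)) (a e) ->
        ('X - (a e)%:P) ^+ k %| \det (N' e) -> ('X - (a e)%:P) ^+ (k + L) %| \det (N e)].
  elim: L {NL} => [|L [N1 N1P N1E]].
    by exists N => // e a1; split=> // k _; rewrite addn0.
  have [N2 N2P N2E] := lower_root_order N1P aP.
  exists N2 => // e a1; have [c1 r1 m1] := N1E e a1; have [c2 r2 m2] := N2E e a1.
  split=> [z z1|z z1 rz|k rz dvk]; first by rewrite c2 ?c1.
    by apply: r1 => //; apply: r2.
  by rewrite addnS -addSn; apply: m1; [apply: r2 | apply: m2].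
exists N' => // e a1 d0; have [c r mu] := N'E e a1; split=> //.
apply/negP => ra; have /(dvdp_leq d0) := mu 0%N ra (dvd1p _).
by rewrite size_exp_XsubC add0n ltnNge NL.
Qed.

(** The points are treated in turn; no step creates a root in the disk, so points already cleared
    stay cleared. *)
Lemma clear_roots (J : eqType) (s : seq J) n (N : env -> 'M_n.+1) (a : J -> env -> C) :
    compP_mx N -> (forall j, comp (a j)) ->
  exists2 N', compP_mx N' & forall e, (forall j, `|a j e| < 1) -> \det (N e) != 0 ->
  [/\ forall z, `|z| = 1 ->
        evmx z (N' e) *m (evmx z (N' e))^t* = evmx z (N e) *m (evmx z (N e))^t*,
      forall z, `|z| < 1 -> root (\det (N' e)) z -> root (\det (N e)) z,
      \det (N' e) != 0
    & forall z, z \in [seq a j e | j <- s] -> ~~ root (\det (N' e)) z].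
Proof.
move=> NP aP; elim: s => [|j s [N1 N1P N1E]].
  by exists N.
have [N2 N2P N2E] := clear_root N1P (aP j).
exists N2 => // e a1 d0; have [c1 r1 d10 m1] := N1E e a1 d0.
have [c2 r2 m2] := N2E e (a1 j) d10.
split=> [z z1|z z1 rz||z]; first by rewrite c2 ?c1.
- by apply: r1 => //; apply: r2.
- by apply: contraNneq m2 => ->; apply: root0.
rewrite inE => /predU1P[->//|zs]; apply: contra (m1 z zs); apply: r2.
by case/mapP: zs => i _ ->.
Qed.

End ClearRoots.

(** * Identities continued from the circle and division by a scalar polynomial *)

Section UnitCircle.
Variable C : numClosedFieldType.
Implicit Types (z : C) (p q x : {poly C}).

Lemma poly_unit_circle_eq0 p : (forall z, `|z| = 1 -> p.[z] = 0) -> p = 0.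
Proof.
move=> p0; apply/eqP; apply/negbNE/negP => pn0.
have imag_neq0 (n : nat) : n%:R - 'i != 0 :> C.
  rewrite subr_eq0; apply/eqP => /(congr1 (fun y : C => y ^+ 2)).
  rewrite sqrCi -natrX => /eqP; rewrite eq_sym lt_eqF //.
  by rewrite (lt_le_trans (ltrN10 _)).
(* Cayley transforms of the natural numbers give infinitely many distinct points of the circle, more
   than a nonzero polynomial has roots. *)
pose c (n : nat) : C := (n%:R + 'i) / (n%:R - 'i).
have c1 n : `|c n| = 1.
  have cE : (n%:R - 'i)^* = n%:R + 'i :> C by rewrite rmorphB /= conjCi rmorph_nat opprK.
  by rewrite normf_div -cE norm_conjC divff ?normr_eq0.
have c_inj : injective c.
  move=> n1 n2 /eqP; rewrite eqr_div // -subr_eq0.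
  rewrite (_ : _ - _ = (n2%:R - n1%:R) * ('i * 2%:R)); last by ring.
  by rewrite !mulf_eq0 (negPf (neq0Ci _)) pnatr_eq0 !orbF subr_eq0 eqr_nat => /eqP.
have := max_poly_roots pn0 (rs := mkseq c (size p)).
rewrite mkseq_uniq // size_mkseq ltnn => H; suff: false by [].
by apply: H => //; apply/allP => _ /mapP[n _ ->]; apply/rootP/p0.
Qed.

(** Laurent polynomials as functions on [C \ {0}], with the pole at 0 cleared by [z ^ K]; the value
    at 0 is left free. *)
Definition laurent_fun (F : C -> C) : Prop :=
  exists K p, forall z, z != 0 -> F z * z ^+ K = p.[z].

Lemma laurent_fun_horner p : laurent_fun (fun z => p.[z]).
Proof. by exists 0, p => z _; rewrite mulr1. Qed.

Lemma laurent_funD F G :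
  laurent_fun F -> laurent_fun G -> laurent_fun (fun z => F z + G z).
Proof.
move=> [K [p pE]] [L [q qE]]; exists (K + L)%N, (p * 'X^L + q * 'X^K) => z z0.
by rewrite !hornerE -pE // -qE // exprD; ring.
Qed.

Lemma laurent_funM F G :
  laurent_fun F -> laurent_fun G -> laurent_fun (fun z => F z * G z).
Proof.
move=> [K [p pE]] [L [q qE]]; exists (K + L)%N, (p * q) => z z0.
by rewrite !hornerE -pE // -qE // exprD mulrACA.
Qed.

Lemma laurent_fun_sum n (F : 'I_n -> C -> C) :
  (forall i, laurent_fun (F i)) -> laurent_fun (fun z => \sum_i F i z).
Proof.
elim: n F => [|n IHn] F FP.
  by exists 0, 0 => z _; rewrite big_ord0 mul0r horner0.
have [K [p pE]] := laurent_funD (FP ord0) (IHn _ (fun i => FP (lift ord0 i))).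
by exists K, p => z z0; rewrite big_ord_recl pE.
Qed.

(** Multiplying by [z ^ size p] turns the negative powers into the conjugated coefficients in
    reverse order. *)
Lemma laurent_fun_reflect p : laurent_fun (fun z => (p.[(z^*)^-1])^*).
Proof.
exists (size p), (\sum_(i < size p) (p`_i)^* *: 'X^(size p - i)) => z z0.
rewrite horner_coef rmorph_sum mulr_suml horner_sum; apply: eq_bigr => i _.
rewrite !hornerE /= rmorphM rmorphXn fmorphV /= conjCK exprVn -mulrA; congr (_ * _).
rewrite -[X in _ * z ^+ X = _](subnK (ltnW (ltn_ord i))) exprD mulrCA mulVf.
  by rewrite mulr1.
by rewrite expf_neq0.
Qed.

(** Multiplication by [x] absorbs the exceptional points: the cleared difference then vanishes on
    the whole circle, hence identically. *)
Lemma laurent_fun_eq x F G : x != 0 -> laurent_fun F -> laurent_fun G ->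
    (forall z, `|z| = 1 -> x.[z] != 0 -> F z = G z) ->
  forall z, z != 0 -> F z = G z.
Proof.
move=> x0 [K [p pE]] [L [q qE]] FG z z0.
have: x * (p * 'X^L - q * 'X^K) = 0.
  apply: poly_unit_circle_eq0 => w w1; rewrite !hornerE.
  have w0 : w != 0 by rewrite -normr_eq0 w1 oner_eq0.
  case: (eqVneq x.[w] 0) => [-> | xw]; first by rewrite mul0r.
  by rewrite -pE // -qE // FG // mulrAC subrr mulr0.
move/eqP; rewrite mulf_eq0 (negPf x0) => /= /eqP/(congr1 (horner^~ z)).
rewrite !hornerE -pE // -qE // mulrAC -mulrBl -mulrBl => /eqP.
by rewrite !mulf_eq0 !expf_eq0 (negPf z0) !andbF !orbF subr_eq0 => /eqP.
Qed.

Lemma laurent_poly_fun (f : {fraction {poly C}}) :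
  laurent_poly f -> laurent_fun (feval f).
Proof.
have X0 z n : z != 0 -> ('X^n : {poly C}).[z] != 0.
  by move=> z0; rewrite hornerXn expf_neq0.
(* The constructor [Negz n] stands for [-(n + 1)], hence the exponent [n.+1]. *)
case=> -[] n [p fE]; [exists 0, ('X^n * p) | exists n.+1, p] => z z0.
  have [||_ ->] := @fevalE C f ('X^n * p) 1 z; rewrite ?hornerE ?oner_eq0 //.
    by rewrite fE rmorph1 divr1 rmorphM rmorphXn.
  by rewrite divr1 ?mulr1.
have [||_ ->] := @fevalE C f p 'X^(n.+1) z; rewrite ?X0 //.
  by rewrite fE rmorphXn mulrC.
by rewrite hornerXn divfK // expf_neq0.
Qed.

(* A root [w] of [q] satisfies [1 <= `|w|]; the relation continued to [C \ {0}]
   gives [N(w) N(1/w^* )^t* = 0]. Either [`|w| > 1] and the second factor is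
   invertible, or [`|w| = 1] and it is [N(w)^t*]. In both cases [N(w) = 0]. *)
Lemma unit_circle_divide n (S : C -> 'M[C]_n) (N : 'M[{poly C}]_n) q x :
    (forall i j, laurent_fun (fun z => S z i j)) -> x != 0 -> q != 0 ->
    (forall z, `|z| < 1 -> ~~ root q z) ->
    (forall z, `|z| < 1 -> ~~ root (\det N) z) ->
    (forall z, `|z| = 1 -> x.[z] != 0 ->
       (q.[z] * q.[z]^*) *: S z = evmx z N *m (evmx z N)^t*) ->
  exists2 G, N = q *: G &
    forall z, z != 0 -> S z = evmx z G *m (evmx ((z^*)^-1) G)^t*.
Proof.
move=> SP; have [k] := ubnP (size q); elim: k => // k IHk in N q x *.
move=> szq x0 q0 qD ND circ.
(* The relation on the circle is continued entrywise, the conjugates being taken at [1 / z^*], which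
   equals [z] on the circle. *)
have ext z : z != 0 ->
    (q.[z] * (q.[(z^*)^-1])^*) *: S z = evmx z N *m (evmx ((z^*)^-1) N)^t*.
  move=> z0; apply/matrixP => i j; move: z z0.
  apply: (laurent_fun_eq x0).
  - have [K [p pE]] := laurent_funM
      (laurent_funM (laurent_fun_horner q) (laurent_fun_reflect q)) (SP i j).
    by exists K, p => z z0; rewrite mxE pE.
  - have [K [p pE]] := laurent_fun_sum (fun l =>
      laurent_funM (laurent_fun_horner (N i l)) (laurent_fun_reflect (N j l))).
    exists K, p => z z0; rewrite -pE // mxE; congr (_ * _).
    by apply: eq_bigr => l _; rewrite !mxE.
  - move=> z z1 xz; have z0 : z != 0 by rewrite -normr_eq0 z1 oner_eq0.
    have -> : (z^*)^-1 = z.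
      by rewrite invC_norm norm_conjC z1 expr1n invr1 mul1r conjCK.
    by rewrite circ.
have [szq1|szq1] := leqP (size q) 1.
  have [c c0 qE] : exists2 c, c != 0 & q = c%:P.
    exists q`_0; last exact: size1_polyC.
    by apply: contraNneq q0 => q00; rewrite (size1_polyC szq1) q00.
  have NE : N = q *: (c^-1%:P *: N).
    by rewrite scalerA qE -polyCM divff // scale1r.
  exists (c^-1%:P *: N) => // z z0; have := ext z z0.
  rewrite {1}NE [in X in _ *m X]NE !evmxZ qE !hornerC => E.
  have cc0 : c * c^* != 0 by rewrite mul_conjC_eq0.
  apply: (scalerI cc0); rewrite {}E.
  by rewrite trmxCZ -[LHS]scalemxAl -scalemxAr scalerA.
have /closed_rootP[w qw] : size q != 1 by rewrite neq_ltn szq1 orbT.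
have w1 : 1 <= `|w|.
  rewrite real_leNgt ?real1 ?normr_real //; apply/negP => /qD; by rewrite qw.
have w0 : w != 0 by rewrite -normr_gt0 (lt_le_trans ltr01).
have Nw : evmx w N = 0.
  have := ext w w0; rewrite (rootP qw) mul0r scale0r => /esym NN.
  move: w1; rewrite le_eqVlt => /predU1P[w1|w1].
    have wE : (w^*)^-1 = w.
      by rewrite invC_norm norm_conjC -w1 expr1n invr1 mul1r conjCK.
    (* A diagonal entry of [N(w) N(w)^*] is the sum of the squared moduli of a row, so the row
       vanishes. *)
    rewrite wE in NN; apply/matrixP => i j; have /matrixP/(_ i i) := NN.
    rewrite !mxE => /eqP; rewrite psumr_eq0 => [/allP/(_ j (mem_index_enum j))|l _].
      by rewrite !mxE mul_conjC_eq0 => /eqP.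
    by rewrite !mxE mul_conjC_ge0.
  have uN : (evmx (w^*)^-1 N)^t* \in unitmx.
    rewrite unitmxE det_map_mx det_tr det_evmx unitfE fmorph_eq0.
    by apply: ND; rewrite normfV norm_conjC invf_lt1 // (lt_trans ltr01).
  by rewrite -(mulmxK uN (evmx w N)) NN mul0mx.
pose q' := q %/ ('X - w%:P); pose N' := map_mx (fun p => p %/ ('X - w%:P)) N.
have qE : q = ('X - w%:P) * q' by rewrite mulrC divpK // dvdp_XsubCl.
have NE : N = ('X - w%:P) *: N'.
  apply/matrixP => i j; rewrite !mxE mulrC divpK // dvdp_XsubCl rootE.
  by have /matrixP/(_ i j) := Nw; rewrite !mxE /horner_eval => ->.
(* Cancelling [|z - w|^2] is legitimate only off [w], so [w] joins the exceptional points by the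
   factor [X - w] in [x]. *)
have [||||||G N'E GS] := IHk N' q' (x * ('X - w%:P)).
- rewrite -ltnS; apply: leq_trans szq; rewrite ltnS size_divp ?polyXsubC_eq0 //.
  by rewrite size_XsubC subn1 prednK // ltnW.
- by rewrite mulf_neq0 // polyXsubC_eq0.
- by apply: contraNneq q0 => q'0; rewrite qE q'0 mulr0.
- by move=> z /qD; apply: contra => r; rewrite qE rootM r orbT.
- by move=> z /ND; apply: contra => r; rewrite NE detZ rootM r orbT.
- move=> z z1; rewrite !hornerE mulf_eq0 negb_or => /andP[xz zw].
  have := circ z z1 xz; rewrite {1 2}qE NE evmxZ !hornerE => E.
  have zz0 : (z - w) * (z - w)^* != 0 by rewrite mul_conjC_eq0.
  apply: (scalerI zz0); rewrite scalerA -mulrACA -rmorphM E.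
  by rewrite trmxCZ -scalemxAl -scalemxAr scalerA.
by exists G; rewrite // NE N'E scalerA -qE.
Qed.

End UnitCircle.

(* Division as power series at [0]: with [u = 1 - q / q(0)], the inverse of [q]
   modulo [X^L] is [q(0)^-1 (1 + u + ... + u^(L-1))]. *)
Lemma comp_quotient (C : numClosedFieldType) I m (p q : (I -> C) -> {poly C}) :
    @compP C I m p -> compP m q ->
  exists2 g, compP m g & forall e G, (q e)`_0 != 0 -> p e = q e * G -> g e = G.
Proof.
move=> pP qP; have [[L pL] _] := pP.
have q0P := compV (qP.2 0%N).
have uP := compPB (compPC (comp1 _ _ _)) (compPZ q0P qP).
have sP := compP_sum (index_enum 'I_L) xpredT (fun k : 'I_L => compP_exp k uP).
have gP := compP_take L (compPM (compPZ q0P pP) sP).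
refine (ex_intro2 _ _ _ gP _) => e G /=; set q0 := (q e)`_0 => q00 pE; set u := 1 - _.
have szG : (size G <= L)%N.
  have [-> | G0] := eqVneq G 0; first by rewrite size_poly0.
  have qn0 : q e != 0 by apply: contraNneq q00; rewrite /q0 => ->; rewrite coef0.
  apply: leq_trans (pL e); rewrite pE; apply: dvdp_leq (dvdp_mulIr _ _).
  by rewrite mulf_neq0.
have uX : u = u %/ 'X * 'X.
  rewrite divpK // -['X]subr0 dvdp_XsubCl rootE horner_coef0.
  by rewrite coefB coef1 coefZ mulVf ?subrr.
have -> : q0^-1 *: p e = (1 - u) * G.
  by rewrite pE scalerAl /u opprB addrCA subrr addr0.
(* The geometric sum times [1 - u] is [1 - u^L]. As [u] is a multiple of [X], truncation at [L]
   removes [u^L G] and keeps [G]. *)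
rewrite mulrAC -[(1 - u) * _]opprK -mulNr opprB -subrX1 opprB.
rewrite mulrBl mul1r uX exprMn [_ * G]mulrAC -mulNr.
exact: take_polyDMXn.
Qed.

(** * Poles and zeros read from an arbitrary reduced form *)

Section ReducedForm.
Variable C : numClosedFieldType.
Implicit Types (f : {fraction {poly C}}) (p q : {poly C}) (z : C).

Lemma feval_tofrac p z : ~~ pole p%:F z /\ feval p%:F z = p.[z].
Proof.
have [||np ->] := @fevalE C p%:F p 1 z; rewrite ?hornerE ?oner_eq0 //.
  by rewrite rmorph1 divr1.
by rewrite divr1.
Qed.

Lemma reduced_form_cross f p q : reduced_form f p q -> p * fden f = fnum f * q.
Proof.
case=> q0 _ fE; have [d0 _ fE'] := fnum_fdenP f.
apply/eqP; rewrite -tofrac_eq !rmorphM /= -eqr_div ?tofrac_eq0 //.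
by rewrite -fE -fE'.
Qed.

Lemma reduced_form_pole f p q z : reduced_form f p q -> root q z -> pole f z.
Proof.
move=> fpq qz; have := congr1 (horner^~ z) (reduced_form_cross fpq).
have [_ cop _] := fpq; rewrite !hornerM (rootP qz) mulr0 => /eqP.
rewrite mulf_eq0 => /orP[pz|//].
by have := coprimep_root cop pz; rewrite (rootP qz) eqxx.
Qed.

Lemma reduced_form_zero f p q z : reduced_form f p q -> root p z -> zero f z.
Proof.
move=> fpq pz; have := congr1 (horner^~ z) (reduced_form_cross fpq).
have [_ cop _] := fpq; rewrite !hornerM (rootP pz) mul0r => /eqP.
rewrite eq_sym mulf_eq0 => /orP[//|qz].
by have := coprimep_root cop pz; rewrite (eqP qz) eqxx.
Qed.

Lemma reduced_form0 p q : reduced_form 0 p q -> p = 0.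
Proof.
case=> q0 _ /esym/eqP; rewrite mulf_eq0 invr_eq0 !tofrac_eq0 (negPf q0) orbF.
by move/eqP.
Qed.

End ReducedForm.

(** * Clearing the denominators of the triangular factor *)

Section CommonDenominator.
Variables (C : numClosedFieldType) (n : nat).
Implicit Types (P Q : 'M[{poly C}]_n) (z : C).

Definition common_den Q : {poly C} := \prod_(x : 'I_n * 'I_n) Q x.1 x.2.

(** This is [M] times [common_den Q], written without division so that its entries are visibly
    polynomial in the data. *)
Definition clear_den P Q : 'M[{poly C}]_n :=
  \matrix_(i, j) (P i j * \prod_(x : 'I_n * 'I_n | x != (i, j)) Q x.1 x.2).

Lemma common_denE Q i j :
  common_den Q = Q i j * \prod_(x : 'I_n * 'I_n | x != (i, j)) Q x.1 x.2.
Proof. by rewrite /common_den (bigD1 (i, j)). Qed.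

Lemma root_common_den Q (s : pred ('I_n * 'I_n)) z :
  root (\prod_(x | s x) Q x.1 x.2) z -> exists i j, root (Q i j) z.
Proof.
rewrite rootE horner_prod => /prodf_eq0[[i j] _ Qz]; by exists i, j.
Qed.

Section Entries.
Variables (M : 'M[{fraction {poly C}}]_n) (P Q : 'M[{poly C}]_n).
Hypothesis MPQ : forall i j, reduced_form (M i j) (P i j) (Q i j).

Lemma common_den_neq0 : common_den Q != 0.
Proof. by apply/prodf_neq0 => -[i j] _; have [] := MPQ i j. Qed.

Lemma common_den_eval z : (common_den Q).[z] != 0 ->
  (forall i j, ~~ pole (M i j) z) /\
  evmx z (clear_den P Q) = (common_den Q).[z] *: mxeval M z.
Proof.
move=> qz.
have ME i j : ~~ pole (M i j) z /\ feval (M i j) z = (P i j).[z] / (Q i j).[z].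
  apply: fevalE; first by have [] := MPQ i j.
  by apply: contraNneq qz => Q0; rewrite (common_denE Q i j) hornerM Q0 mul0r.
split=> [i j|]; first by have [] := ME i j.
apply/matrixP => i j; rewrite !mxE (ME i j).2 /horner_eval (common_denE Q i j).
rewrite !hornerM.
have Q0 : (Q i j).[z] != 0.
  by apply: contraNneq qz => Q0; rewrite (common_denE Q i j) hornerM Q0 mul0r.
by rewrite [RHS]mulrC mulrA divfK.
Qed.

Hypothesis Mtrig : is_trig_mx M.
Hypothesis Mdiag :
  forall i z, `|z| < 1 -> ~~ pole (M i i) z && ~~ zero (M i i) z.

Lemma num_upper (i j : 'I_n) : (i < j)%N -> P i j = 0.
Proof.
move=> ltij; apply: (@reduced_form0 _ _ (Q i j)).
by have := MPQ i j; rewrite (is_trig_mxP Mtrig).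
Qed.

(** Diagonal entries have no pole in the disk, and a zero entry above the diagonal has a constant
    coprime denominator; only strictly lower entries remain. *)
Lemma den_root z i j : `|z| < 1 -> root (Q i j) z -> (j < i)%N /\ pole (M i j) z.
Proof.
move=> z1 Qz; have poleM := reduced_form_pole (MPQ i j) Qz; split=> //.
case: ltngtP => // [ltij | /val_inj ij]; last first.
  by have := Mdiag i z1; rewrite -{2}ij poleM.
have [_ cop _] := MPQ i j; have := @coprimep_root _ _ _ z cop.
by rewrite (num_upper ltij) root0 (rootP Qz) eqxx => /(_ isT).
Qed.

Lemma det_clear_den : \det (clear_den P Q) = \prod_i clear_den P Q i i.
Proof.
apply: det_trig; apply/is_trig_mxP => i j ltij.
by rewrite mxE num_upper ?mul0r.
Qed.

(** The determinant is the product of the diagonal, whose numerators have no zeros in the disk, so a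
    root must come from a denominator. *)
Lemma det_clear_den_root z : `|z| < 1 -> root (\det (clear_den P Q)) z ->
  exists i j, root (Q i j) z.
Proof.
move=> z1; rewrite det_clear_den rootE horner_prod => /prodf_eq0[i _].
rewrite mxE hornerM mulf_eq0 => /orP[/(reduced_form_zero (MPQ i i)) z0|].
  by have := Mdiag i z1; rewrite z0 andbF.
exact: root_common_den.
Qed.

Lemma det_clear_den_neq0 : \det (clear_den P Q) != 0.
Proof.
rewrite det_clear_den; apply/prodf_neq0 => i _; rewrite mxE mulf_neq0 //.
  (* A zero numerator would make the point 0 of the disk a zero of the diagonal entry. *)
  have := Mdiag i (z := 0); rewrite normr0 ltr01 => /(_ isT)/andP[_].
  apply: contraNneq => P0; apply: (reduced_form_zero (MPQ i i)).
  by rewrite P0 root0.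
by apply/prodf_neq0 => -[k l] _; have [] := MPQ k l.
Qed.

End Entries.
End CommonDenominator.

Theorem theorem1p2 (R : realType) (r d k : nat) (r_gt0 : (0 < r)%N) :
  exists T : exact_tree (datum r d k) r,
  forall (S M : 'M[{fraction {poly R[i]}}]_r)
         (P Q : 'M[{poly R[i]}]_r) (a : k.-tuple R[i]),
    (forall i j, laurent_poly (S i j)) ->
    posdef_ae S ->
    lower_upper_factorization S M ->
    (forall i j, reduced_form (M i j) (P i j) (Q i j)) ->
    (forall i j, (size (P i j) <= d)%N /\ (size (Q i j) <= d)%N) ->
    (forall z : R[i], z \in a <->
       `|z| < 1 /\ exists i j : 'I_r, (j < i)%N /\ pole (M i j) z) ->
    spectral_factor S (run_tree (known_data P Q a) T).
Proof.
case: r r_gt0 => // n _; set C : numClosedFieldType := R[i].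
pose env := datum n.+1 d k -> C.
(* [numE] and [denE] rebuild [P] and [Q] from an arbitrary environment, since the tree must be fixed
   before the data are given. *)
pose numE (e : env) : 'M[{poly C}]_n.+1 :=
  \matrix_(i, j) \sum_(l < d) (e (NumCoef k i j l))%:P * 'X^l.
pose denE (e : env) : 'M[{poly C}]_n.+1 :=
  \matrix_(i, j) \sum_(l < d) (e (DenCoef k i j l))%:P * 'X^l.
have numP : compP_mx n.+1 numE.
  move=> i j; apply: compP_ext (compP_sum (index_enum 'I_d) xpredT (fun l : 'I_d =>
    compPM (compPC (comp_var C _ (NumCoef k i j l)))
      (compP_exp l (compPX C _ _)))) _ => e.
  by rewrite mxE.
have denP : compP_mx n.+1 denE.
  move=> i j; apply: compP_ext (compP_sum (index_enum 'I_d) xpredT (fun l : 'I_d =>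
    compPM (compPC (comp_var C _ (DenCoef k i j l)))
      (compP_exp l (compPX C _ _)))) _ => e.
  by rewrite mxE.
have NP : compP_mx n.+1 (fun e => clear_den (numE e) (denE e)).
  move=> i j; apply: compP_ext (compPM (numP i j)
    (compP_prod (index_enum _) (fun x => x != (i, j)) (fun x => denP x.1 x.2))) _ => e.
  by rewrite [RHS]mxE.
have qP : compP_mx n.+1 (fun e => (common_den (denE e))%:M : 'M_1).
  move=> i j; apply: compP_ext
    (compP_prod (index_enum _) xpredT (fun x => denP x.1 x.2)) _ => e.
  by rewrite !ord1 mxE eqxx mulr1n.
have aP (l : 'I_k) : @comp C (datum n.+1 d k) n.+1 (fun e => e (PolePoint _ _ l)).
  exact: comp_var.
have [Np NpP NpE] := clear_roots (enum 'I_k) NP aP.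
have [qp qpP qpE] := clear_roots (enum 'I_k) qP aP.
have /fin_all_exists2[g gP gE] (x : 'I_n.+1 * 'I_n.+1) :=
  comp_quotient (NpP x.1 x.2) (qpP 0 0).
have [T TE] : exists T, forall e, run_tree e T = \matrix_(i, j) g (i, j) e.
  apply: compP_mx_run => i j; apply: compP_ext (gP (i, j)) _ => e.
  by rewrite mxE.
exists T => S M P Q a SL _ [Mtrig Mdiag SM] MPQ szPQ aE.
rewrite TE; set e := known_data P Q a.
have polyE (p : {poly C}) : (size p <= d)%N -> \sum_(l < d) (p`_l)%:P * 'X^l = p.
  move=> szp; transitivity (\poly_(l < d) p`_l); last first.
    apply/polyP => i; rewrite coef_poly; case: ltnP => // ledi.
    by rewrite nth_default // (leq_trans szp).
  by rewrite poly_def; apply: eq_bigr => l _; rewrite mul_polyC.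
have numQ : numE e = P by apply/matrixP => i j; rewrite mxE polyE //; case: (szPQ i j).
have denQ : denE e = Q by apply/matrixP => i j; rewrite mxE polyE //; case: (szPQ i j).
have {}Mdiag i z : `|z| < 1 -> ~~ pole (M i i) z && ~~ zero (M i i) z.
  by have [H _] := Mdiag i; apply: H.
have a1 (l : 'I_k) : `|e (PolePoint _ _ l)| < 1.
  by have /aE[] := mem_tnth l a.
(* Every root of a denominator in the disk is a listed point, so clearing the listed points clears
   the disk. *)
have aroot z : `|z| < 1 -> (exists i j, root (Q i j) z) ->
    z \in [seq e (PolePoint _ _ l) | l <- enum 'I_k].
  move=> z1 [i [j Qz]]; have [ltji poleM] := den_root MPQ Mtrig Mdiag z1 Qz.
  have /tnthP[l ->] : z \in a by apply/aE; split=> //; exists i, j.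
  by apply/mapP; exists l => //; rewrite mem_enum.
have := NpE e a1; have := qpE e a1; rewrite {NpE qpE} numQ denQ.
set N := clear_den P Q; set q := common_den Q.
rewrite det_scalar1 => /(_ (common_den_neq0 MPQ)) [qc qr qn0 qa].
move=> /(_ (det_clear_den_neq0 MPQ Mtrig Mdiag)) [Nc Nr _ Na].
set Nf := Np e in Nc Nr Na; set qf := qp e 0 0.
have qfE : qp e = qf%:M by rewrite [LHS]mx11_scalar.
rewrite qfE det_scalar1 in qr qn0 qa.
have qD z : `|z| < 1 -> ~~ root qf z.
  move=> z1; apply/negP => qfz; have := qa z; rewrite qfz => /(_ _)/negP.
  by apply=> //; apply: aroot => //; apply: root_common_den (qr z z1 qfz).
have ND z : `|z| < 1 -> ~~ root (\det Nf) z.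
  move=> z1; apply/negP => Nfz; have := Na z; rewrite Nfz => /(_ _)/negP.
  apply=> //; apply: aroot => //.
  by apply: (det_clear_den_root MPQ Mtrig Mdiag z1); apply: Nr.
(* Points of the circle with [q.[z] = 0] are set aside, as [M] may have poles there; [q] serves as
   the exceptional polynomial. *)
have circ z : `|z| = 1 -> q.[z] != 0 ->
    (qf.[z] * qf.[z]^*) *: mxeval S z = evmx z Nf *m (evmx z Nf)^t*.
  move=> z1 qz; have [npole NM] := common_den_eval MPQ qz.
  rewrite Nc // NM trmxCZ -scalemxAl -scalemxAr scalerA -SM //.
  congr (_ *: _); have /matrixP/(_ 0 0) := qc z z1.
  by rewrite qfE !mxE !big_ord1 !mxE eqxx !mulr1n.
have SF i j : laurent_fun (fun z => mxeval S z i j).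
  have [K [p pE]] := laurent_poly_fun (SL i j).
  by exists K, p => z z0; rewrite mxE pE.
have [G NG GS] := unit_circle_divide SF (common_den_neq0 MPQ) qn0 qD ND circ.
have -> : (\matrix_(i, j) g (i, j) e) = G.
  (* Power series division at 0 applies because [qf] has no root in the disk, in particular not at
     0. *)
  apply/matrixP => i j; rewrite mxE; apply: gE.
    have := qD 0; rewrite normr0 ltr01 => /(_ isT).
    by rewrite rootE horner_coef0.
  by rewrite -/Nf NG mxE.
split=> [z z0 | z z1]; last first.
  have := ND z z1; rewrite NG detZ rootM negb_or => /andP[_].
  by rewrite rootE.
rewrite GS //; congr (_ *m _); apply/matrixP => i j; rewrite !mxE.
  by rewrite (feval_tofrac _ _).2.
by rewrite (ftildeE z0 (feval_tofrac _ _).1).2 (feval_tofrac _ _).2.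
Qed.
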